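(* Let $f\colon X\to X$ be a topologically hyperbolic homeomorphism of a Peano continuum $X$ and let $d$ be a conformal hyperbolic distance for $f$, with induced maps $d^s,d^u$ and lengths $\ell^s,\ell^u$. If $\gamma^u\colon[0,1]\to X$ is an unstable curve with $0<\ell^u(\gamma^u)<+\infty$, then $\gamma^u$ has globally defined holonomy. Likewise, if $\gamma^s\colon[0,1]\to X$ is a stable curve with $0<\ell^s(\gamma^s)<+\infty$, then $\gamma^s$ has globally defined holonomy.
   Context: A Peano continuum is a compact, connected, locally connected metric space. Let $d$ be a metric compatible with the topology of $X$. $W^s(x)=\{y: d(f^n(y),f^n(x))\to0,\ n\to\infty\}$, $W^u(x)=\{y: d(f^n(y),f^n(x))\to0,\ n\to-\infty\}$; for $\varepsilon>0$, $W^s_\varepsilon(x)=\{y: d(f^k(y),f^k(x))\le\varepsilon\ \forall k\ge0\}$ and $W^u_\varepsilon(x)=\{y: d(f^k(y),f^k(x))\le\varepsilon\ \forall k\le0\}$. $f$ is expansive if there is $c>0$ with $W^s_c(x)\cap W^u_c(x)=\{x\}$ for every $x$. $f$ has the local-product-structure if for each $\varepsilon>0$ there is $\delta>0$ such that $W^s_\varepsilon(x)\cap W^u_\varepsilon(y)\ne\emptyset$ whenever $d(x,y)<\delta$. $f$ is topologically hyperbolic if it is expansive and has the local-product-structure. $d$ is a conformal hyperbolic distance for $f$ if there are constants $\xi>0$ (expansive constant) and $\lambda>1$ (expanding factor) such that for all $x\in X$, $y\in W^s_\xi(x)$, $z\in W^u_\xi(x)$ and $k\ge0$: $d(f^k(y),f^k(x))=\lambda^{-k}d(y,x)$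 and $d(f^{-k}(z),f^{-k}(x))=\lambda^{-k}d(z,x)$. For $y\in W^s(z)$, $d^s(y,z)=\lambda^{n}d(f^{n}(y),f^{n}(z))$ where $n=n(y,z)$ is the first integer $n\ge0$ with $f^n(z)\in W^s_\xi(f^n(y))$. For $y\in W^u(z)$, $d^u(y,z)=\lambda^{n}d(f^{-n}(y),f^{-n}(z))$ where $n$ is the first integer $n\ge0$ with $f^{-n}(z)\in W^u_\xi(f^{-n}(y))$. A stable (unstable) curve is a continuous curve whose image is contained in a single stable (unstable) set. For $\sigma\in\{s,u\}$ and a stable (if $\sigma=s$) or unstable (if $\sigma=u$) curve $\gamma\colon[a,b]\to X$, $\ell^\sigma(\gamma)=\sup_P\sum_{i=0}^{n-1}d^\sigma(\gamma(a_{i+1}),\gamma(a_i))$, the supremum being over all partitions $P=\{a=a_0<\dots<a_n=b\}$. An unstable curve $\gamma^u\colon[0,1]\to X$ has globally defined holonomy if for any stable curve $\gamma^s\colon[0,1]\to X$ with $\gamma^s(0)=\gamma^u(0)$ there is a continuous map $g\colon[0,1]\times[0,1]\to X$ such that $g(0,\cdot)=\gamma^s$, $g(\cdot,0)=\gamma^u$, $g(t,\cdot)$ is a stable curve for every $t\in[0,1]$, and $g(\cdot,t)$ is an unstable curve for every $t\in[0,1]$. A stable curve $\gamma^s\colon[0,1]\to X$ has globally defined holonomy if the same conclusion holds for any unstable curve $\gamma^u\colon[0,1]\to X$ with $\gamma^u(0)=\gamma^s(0)$. *)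

(* Defs.v *)
From mathcomp Require Import all_boot all_order all_algebra.
From mathcomp Require Import all_classical all_reals all_analysis.

Set Implicit Arguments.
Unset Strict Implicit.
Unset Printing Implicit Defensive.

Import Order.TTheory GRing.Theory Num.Theory.
Import numFieldNormedType.Exports.

Local Open Scope classical_set_scope.
Local Open Scope ring_scope.

Definition locally_connected (X : topologicalType) :=
  forall (x : X) (U : set X), nbhs x U ->
    exists V : set X, [/\ open V, connected V, V x & V `<=` U].

(* The metric is part of the structure of [X : metricType R]. *)
Definition peano_continuum (R : realType) (X : metricType R) :=
  [/\ compact [set: X], connected [set: X] & locally_connected X].

Record homeo (X : topologicalType) := Homeo {
  homeo_fun :> X -> X;
  homeo_inv : X -> X;
  homeo_funK : cancel homeo_fun homeo_inv;
  homeo_invK : cancel homeo_inv homeo_fun;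
  homeo_fun_continuous : continuous homeo_fun;
  homeo_inv_continuous : continuous homeo_inv }.

Inductive side := stable | unstable.

Section Dynamics.
Context {R : realType} {X : metricType R}.
Implicit Types (f : homeo X) (sg : side) (x y z : X).

(* [fpow f stable n] is f^n and [fpow f unstable n] is f^(-n). *)
Definition fpow f sg (n : nat) : X -> X :=
  match sg with
  | stable => iter n f
  | unstable => iter n (homeo_inv f)
  end.

Definition W f sg x : set X :=
  [set y | mdist (fpow f sg n y) (fpow f sg n x) @[n --> \oo] --> (0 : R)].

Definition Wloc f sg (e : R) x : set X :=
  [set y | forall k : nat, mdist (fpow f sg k y) (fpow f sg k x) <= e].

Definition expansive f :=
  exists2 c : R, 0 < c &
    forall x, Wloc f stable c x `&` Wloc f unstable c x = [set x].

Definition local_product_structure f :=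
  forall e : R, 0 < e -> exists2 delta : R, 0 < delta &
    forall x y, mdist x y < delta ->
      Wloc f stable e x `&` Wloc f unstable e y !=set0.

Definition topologically_hyperbolic f :=
  expansive f /\ local_product_structure f.

Definition conformal_hyperbolic f (xi lambda : R) :=
  [/\ 0 < xi, 1 < lambda &
    forall x y z, Wloc f stable xi x y -> Wloc f unstable xi x z ->
    forall k : nat,
      mdist (fpow f stable k y) (fpow f stable k x) = lambda ^- k * mdist y x
      /\ mdist (fpow f unstable k z) (fpow f unstable k x)
         = lambda ^- k * mdist z x].

(* The first n >= 0 such that f^(+-n)(z) lies in the local set of size xi at
   f^(+-n)(y). Such an n exists when y is in the stable (unstable) set of z;
   otherwise the value may be the default 0, and is never used. *)
Definition entry_time f (xi : R) sg y z : nat :=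
  match pselect (exists n, `[< Wloc f sg xi (fpow f sg n y) (fpow f sg n z) >])
  with
  | left ex => ex_minn ex
  | right _ => 0%N
  end.

Definition leaf_dist f (xi lambda : R) sg y z : R :=
  let n := entry_time f xi sg y z in
  lambda ^+ n * mdist (fpow f sg n y) (fpow f sg n z).

(* A curve [a, b] -> X is a total function R -> X of which only the
   restriction to [a, b] matters. *)
Definition leaf_curve f sg (a b : R) (gamma : R -> X) :=
  {within `[a, b], continuous gamma} /\
  exists x, gamma @` `[a, b] `<=` W f sg x.

Definition partition_length f (xi lambda : R) sg (a b : R) (gamma : R -> X)
    (s : seq R) : R :=
  let F := gamma \o nth b (a :: s) in
  \sum_(0 <= i < size s) leaf_dist f xi lambda sg (F i.+1) (F i).

Definition leaf_length f (xi lambda : R) sg (a b : R) (gamma : R -> X)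
    : \bar R :=
  ereal_sup [set (partition_length f xi lambda sg a b gamma s)%:E
            | s in itv_partition a b].

Definition holonomy f (gammas gammau : R -> X) :=
  exists g : R * R -> X,
    [/\ {within `[0, 1] `*` `[0, 1], continuous g},
        forall t, t \in `[0, 1] -> g (0, t) = gammas t,
        forall t, t \in `[0, 1] -> g (t, 0) = gammau t,
        forall t, t \in `[0, 1] ->
          leaf_curve f stable 0 1 (fun r => g (t, r)) &
        forall t, t \in `[0, 1] ->
          leaf_curve f unstable 0 1 (fun r => g (r, t))].

Definition global_holonomy_unstable f (gammau : R -> X) :=
  forall gammas, leaf_curve f stable 0 1 gammas -> gammas 0 = gammau 0 ->
  holonomy f gammas gammau.

Definition global_holonomy_stable f (gammas : R -> X) :=
  forall gammau, leaf_curve f unstable 0 1 gammau -> gammau 0 = gammas 0 ->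
  holonomy f gammas gammau.

End Dynamics.

(* Main.v *)
(* Along a local product box with sides u, u' in one direction and s, s' in the
   other, iterate until u or u' reaches a fixed size: u and u' have been
   multiplied by some lambda^k, s and s' by lambda^-k, so the triangle inequality
   gives |u' - u| <= C u^2 (s + s'), and likewise |s' - s| <= C s^2 (u + u').
   The errors being quadratic, transporting a rectifiable curve along the other
   foliation preserves its length in the limit of fine partitions. Hence the
   transversal distance by which a curve of length at most L can be displaced is
   bounded below by a number depending only on L, and finitely many displacements
   cover the given transversal curve. *)
Require Import Defs.
From mathcomp Require Import all_boot all_order all_algebra.
From mathcomp Require Import all_classical all_reals all_analysis.
From mathcomp Require Import ring lra.
Import Order.TTheory GRing.Theory Num.Theory.
Import numFieldNormedType.Exports.

Set Implicit Arguments.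
Unset Strict Implicit.
Unset Printing Implicit Defensive.

Local Open Scope classical_set_scope.
Local Open Scope ring_scope.

(** The box estimate concerns local sets, whereas a curve in a leaf is only known to lie in a global
    set, which may cross a small region in many separate pieces. Jumps between the pieces are
    excluded by countability: a leaf meets a small transverse slice in a countable set, and a
    continuous curve with countable range is constant. The second obstacle is accumulation. Boxes
    must be small, so many are needed, and the crude ratio 2 between opposite sides would compound
    exponentially along a chain. In the quadratic estimate the growth of the transverse side s
    across one box is proportional to the length of that box, so the total growth is of order s^2 L
    whatever the number of boxes. Product points are obtained by mere choice; their continuity comes
    from a quantitative form of expansiveness. Clipping the chain of grid points at the running
    parameter gives every parameter the same number of brackets, so continuity passes to the end of
    the chain. *)

Definition opp_side (sg : side) : side :=
  match sg with stable => unstable | unstable => stable end.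

Lemma opp_sideK : involutive opp_side. Proof. by case. Qed.

(** * Continuity and uniform continuity in terms of the distance *)

Section MetricContinuity.
Context {R : realType}.

Lemma continuousPdist (X : metricType R) (T : topologicalType) (g : T -> X) (x : T) :
  g y @[y --> x] --> g x <->
  forall e : R, 0 < e -> \forall y \near x, mdist (g x) (g y) <= e.
Proof. exact: metricType_numDomainType.cvgrPdist_le. Qed.

Lemma near_mdist_le (X : metricType R) (x : X) (e : R) :
  0 < e -> \forall y \near x, mdist x y <= e.
Proof. by move=> e0; exact: (continuousPdist (@idfun X) x).1. Qed.

Lemma near_mdist_lt (X : metricType R) (x : X) (e : R) :
  0 < e -> \forall y \near x, mdist x y < e.
Proof.
move=> e0; have e20 : 0 < e / 2 by rewrite divr_gt0.
apply: filterS (near_mdist_le x e20) => y xy.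
by apply: le_lt_trans xy _; rewrite ltr_pdivrMr// ltr_pMr// ltr1n.
Qed.

Lemma continuous_mdist_l (X : metricType R) (x : X) : continuous (mdist x : X -> R).
Proof.
move=> y; apply/cvgrPdist_le => e e0; apply: filterS (near_mdist_le y e0) => z yz.
have := metric_triangle x y z; have := metric_triangle x z y.
by rewrite (metric_sym z y) ler_norml; lra.
Qed.

(** Only [x] is confined to [K]: parameter windows around points of [0, 1] may stick out of the
    interval. *)
Lemma compact_unif_dist (X Y : metricType R) (K : set X) (g : X -> Y) (e : R) :
  compact K -> continuous g -> 0 < e ->
  exists2 h : R, 0 < h & forall x y, K x -> mdist x y <= h -> mdist (g x) (g y) <= e.
Proof.
move=> /compact_near_coveringP cK gc e0.
have e20 : 0 < e / 2 by rewrite divr_gt0.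
have := cK R 0^'+ (fun h x => forall y, mdist x y <= h -> mdist (g x) (g y) <= e) _.
case=> [x _|h /= h0 H].
  have [r r0 xr] : exists2 r : R, 0 < r &
      forall y, mdist x y < r -> mdist (g x) (g y) <= e / 2.
    have := (continuousPdist g x).1 (gc x) _ e20.
    by move=> /metricType_numDomainType.nbhs_mdistP[r r0 xr]; exists r.
  have r20 : 0 < r / 2 by rewrite divr_gt0.
  exists ([set x' | mdist x x' < r / 2], [set h | h < r / 2]) => /=.
    split; first exact: near_mdist_lt.
    exact: nbhs_right_lt.
  move=> [x' h] /= [xx' hr] y x'y.
  have := xr x'; have := xr y; have := metric_triangle x x' y.
  have := metric_triangle (g x') (g x) (g y); rewrite (metric_sym (g x') (g x)).
  move=> H1 H2 H3 H4.
  have := H3 ltac:(lra); have := H4 ltac:(lra); lra.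
exists (h / 2); first by rewrite divr_gt0.
move=> x y Kx xy; apply: (H (h / 2)) => //=; last 1 first.
- by rewrite divr_gt0.
- rewrite sub0r normrN gtr0_norm ?divr_gt0//.
  by rewrite ltr_pdivrMr// ltr_pMr// ltr1n.
Qed.

End MetricContinuity.

(** * Iterates, local sets and global sets *)

Section LocalSets.
Context {R : realType} {X : metricType R} (f : homeo X).
Implicit Types (sg : side) (x y z : X).

Lemma fpowD sg m n x : fpow f sg (m + n) x = fpow f sg m (fpow f sg n x).
Proof. by case: sg; rewrite /fpow iterD. Qed.

Lemma fpow_oppK sg n : cancel (fpow f sg n) (fpow f (opp_side sg) n).
Proof.
elim: n => [|n IHn] x; first by case: sg.
have -> : fpow f (opp_side sg) n.+1 (fpow f sg n.+1 x) =
    fpow f (opp_side sg) n (fpow f (opp_side sg) 1 (fpow f sg 1 (fpow f sg n x))).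
  by rewrite -!fpowD addn1 add1n.
rewrite -[RHS]IHn; congr (fpow _ _ _ _).
by case: {IHn} sg; rewrite /= ?homeo_funK ?homeo_invK.
Qed.

Lemma fpow_continuous sg n : continuous (fpow f sg n).
Proof.
elim: n => [|n IHn] x; first by case: sg; exact: cvg_id.
case: sg IHn => /= IHn; apply: continuous_comp; try exact: IHn.
  exact: homeo_fun_continuous.
exact: homeo_inv_continuous.
Qed.

Lemma Wloc_refl sg e x : 0 <= e -> Wloc f sg e x x.
Proof. by move=> e0 k; rewrite mdistxx. Qed.

Lemma Wloc_sym sg e x y : Wloc f sg e x y -> Wloc f sg e y x.
Proof. by move=> xy k; rewrite metric_sym; exact: xy. Qed.

Lemma Wloc_trans sg e1 e2 y x z :
  Wloc f sg e1 x y -> Wloc f sg e2 y z -> Wloc f sg (e1 + e2) x z.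
Proof.
move=> xy yz k; apply: le_trans (metric_triangle _ (fpow f sg k y) _) _.
by rewrite addrC lerD.
Qed.

Lemma Wloc_le sg e1 e2 x y : e1 <= e2 -> Wloc f sg e1 x y -> Wloc f sg e2 x y.
Proof. by move=> e12 xy k; exact: le_trans (xy k) e12. Qed.

Lemma Wloc_dist sg e x y : Wloc f sg e x y -> mdist x y <= e.
Proof. by move=> /(_ 0%N); rewrite metric_sym; case: sg. Qed.

Lemma W_refl sg x : W f sg x x.
Proof.
rewrite /W/=; under eq_fun do rewrite mdistxx; exact: cvg_cst.
Qed.

Lemma WP sg x y : W f sg x y <->
  forall e, 0 < e -> \forall n \near \oo, mdist (fpow f sg n y) (fpow f sg n x) <= e.
Proof.
split=> [/cvgrPdist_le xy e /xy|xy].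
  by apply: filterS => n; rewrite sub0r normrN ger0_norm// mdist_ge0.
apply/cvgrPdist_le => e /xy; apply: filterS => n.
by rewrite sub0r normrN ger0_norm// mdist_ge0.
Qed.

Lemma W_trans sg y x z : W f sg x y -> W f sg y z -> W f sg x z.
Proof.
move=> /WP xy /WP yz; apply/WP => e e0; have e20 : 0 < e / 2 by rewrite divr_gt0.
apply: filterS2 (xy _ e20) (yz _ e20) => n xyn yzn.
by have := metric_triangle (fpow f sg n z) (fpow f sg n y) (fpow f sg n x); lra.
Qed.

Lemma W_Wloc sg x y e : 0 < e -> W f sg x y ->
  exists n, Wloc f sg e (fpow f sg n x) (fpow f sg n y).
Proof.
move=> e0 /WP/(_ _ e0)[n _ xyn]; exists n => k; rewrite -!fpowD.
by apply: xyn; rewrite /= leq_addl.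
Qed.

End LocalSets.

(** * Local product boxes and brackets *)

Lemma exists_exp_gt (R : realType) (lambda m b : R) :
  1 < lambda -> 0 < m -> exists k, b < lambda ^+ k * m.
Proof.
move=> l1 m0.
have li : `|lambda^-1| < 1.
  by rewrite ger0_norm ?invr_ge0 ?(le_trans ler01 (ltW l1))// invf_lt1// (lt_trans ltr01).
have l0 : 0 < lambda by exact: lt_trans l1.
have b0 : 0 < m / (`|b| + 1) by rewrite divr_gt0// ltr_wpDl.
have /cvgrPdist_lt/(_ _ b0)[k _ /(_ k (leqnn k))] := cvg_expr li.
rewrite /= sub0r normrN normrX ger0_norm ?invr_ge0 ?(ltW l0)// exprVn.
rewrite ltr_pdivlMr ?ltr_wpDl// mulrC ltr_pdivrMr ?exprn_gt0// mulrC => H.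
by exists k; apply: le_lt_trans H; rewrite ler_wpDr// ler_norm.
Qed.

Lemma exists_gt0_le2 (R : realType) (a b : R) : 0 < a -> 0 < b ->
  exists2 e : R, 0 < e & e <= a /\ e <= b.
Proof.
move=> a0 b0; exists (Num.min a b); first by rewrite lt_min a0.
by rewrite !ge_min !lexx orbT.
Qed.

Section Conformal.
Context {R : realType} {X : metricType R} (f : homeo X) (xi lambda : R).
Context (hconf : conformal_hyperbolic f xi lambda).
Implicit Types (sg : side) (x y z w : X) (k n : nat).

Lemma xi_gt0 : 0 < xi. Proof. by case: hconf. Qed.
Lemma lambda_gt1 : 1 < lambda. Proof. by case: hconf. Qed.
Lemma lambda_gt0 : 0 < lambda. Proof. exact: lt_trans lambda_gt1. Qed.

Lemma Wloc_fpow_dist sg x y k : Wloc f sg xi x y ->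
  mdist (fpow f sg k x) (fpow f sg k y) = lambda ^- k * mdist x y.
Proof.
case: hconf => xi0 _ H xy.
have refl sg' : Wloc f sg' xi x x by apply: Wloc_refl; exact: ltW.
case: sg xy => xy; rewrite metric_sym (metric_sym x y).
  by have [] := H _ _ _ xy (refl _) k.
by have [] := H _ _ _ (refl _) xy k.
Qed.

(** Conformality makes the distance along the orbit largest at time 0, so inside a [xi]-local set
    the size is read off the initial distance. *)
Lemma Wloc_small sg e x y :
  Wloc f sg xi x y -> mdist x y <= e -> Wloc f sg e x y.
Proof.
move=> xy xye k; rewrite metric_sym Wloc_fpow_dist//; apply: le_trans xye.
rewrite ler_piMl ?mdist_ge0// invf_le1 ?exprn_gt0 ?lambda_gt0//.
by rewrite exprn_ege1// ltW// lambda_gt1.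
Qed.

Lemma Wloc_W sg x y : Wloc f sg xi x y -> W f sg x y.
Proof.
move=> xy; rewrite /W/=.
under eq_fun do rewrite metric_sym Wloc_fpow_dist// -exprVn.
rewrite -(mul0r (mdist x y)); apply: cvgMl; apply: cvg_expr.
rewrite ger0_norm ?invr_ge0 ?(ltW lambda_gt0)//.
by rewrite invf_lt1 ?lambda_gt0// lambda_gt1.
Qed.

(** The [sg]-orbit of the iterated pair first retraces the [n] steps and then follows the [sg]-orbit
    of the original pair; only the retraced part needs a new check. *)
Lemma Wloc_opp_fpow sg e n x y : Wloc f sg e x y ->
  (forall j, (j <= n)%N ->
     mdist (fpow f (opp_side sg) j x) (fpow f (opp_side sg) j y) <= e) ->
  Wloc f sg e (fpow f (opp_side sg) n x) (fpow f (opp_side sg) n y).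
Proof.
move=> xy H k; rewrite metric_sym.
have oppK m z : fpow f sg m (fpow f (opp_side sg) m z) = z.
  by have := @fpow_oppK _ _ f (opp_side sg) m z; rewrite opp_sideK.
have [nk|kn] := leqP n k.
  rewrite -(subnK nk) !fpowD !oppK metric_sym; exact: xy.
rewrite -(subnKC (ltnW kn)) !fpowD !oppK; apply: H; exact: leq_subr.
Qed.

Lemma Wloc_opp_fpow_dist sg n x y :
  Wloc f sg xi (fpow f (opp_side sg) n x) (fpow f (opp_side sg) n y) ->
  mdist (fpow f (opp_side sg) n x) (fpow f (opp_side sg) n y)
  = lambda ^+ n * mdist x y.
Proof.
have oppK m z : fpow f sg m (fpow f (opp_side sg) m z) = z.
  by have := @fpow_oppK _ _ f (opp_side sg) m z; rewrite opp_sideK.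
move=> /(Wloc_fpow_dist n); rewrite !oppK => ->.
by rewrite mulVKf// expf_neq0// gt_eqF// lambda_gt0.
Qed.

(** One step in the direction [opp_side sg] multiplies the distance both by [lambda] and by its
    inverse, so the distance vanishes. *)
Lemma Wloc_eq sg x y :
  Wloc f sg xi x y -> Wloc f (opp_side sg) xi x y -> x = y.
Proof.
move=> xy xy'.
have H : Wloc f sg xi (fpow f (opp_side sg) 1 x) (fpow f (opp_side sg) 1 y).
  by apply: Wloc_opp_fpow => // j _; rewrite metric_sym; exact: xy'.
have := Wloc_opp_fpow_dist H; rewrite (Wloc_fpow_dist 1 xy') expr1 => E.
apply: mdist_positivity; apply/eqP; move: E; apply: contra_eqT => d0.
have dp : 0 < mdist x y by rewrite lt_def d0 mdist_ge0.
rewrite -subr_eq0 -mulrBl mulf_neq0// subr_eq0 lt_eqF//.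
apply: lt_trans lambda_gt1; by rewrite invf_lt1 ?lambda_gt0// lambda_gt1.
Qed.

Section Box.
Variable eta : R.
Hypothesis eta_gt0 : 0 < eta.
Hypothesis etaP : forall sg x y, mdist x y <= eta ->
  mdist (fpow f sg 1 x) (fpow f sg 1 y) <= xi.

Lemma box_dist sg x y z w m :
  Wloc f sg xi x z -> Wloc f sg xi y w ->
  Wloc f (opp_side sg) xi x y -> Wloc f (opp_side sg) xi z w ->
  mdist x z <= m -> mdist y w <= m ->
  `|mdist y w - mdist x z| <= (m / eta) ^+ 2 * (mdist x y + mdist z w).
Proof.
move=> xz yw xy zw xzm ywm.
have [m0|m0] := leP m 0.
  have -> : mdist x z = 0 by apply/le_anti; rewrite mdist_ge0 (le_trans xzm).
  have -> : mdist y w = 0 by apply/le_anti; rewrite mdist_ge0 (le_trans ywm).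
  by rewrite subr0 normr0 mulr_ge0 ?sqr_ge0// addr_ge0// mdist_ge0.
(* Before time [k] the growing sides are at most [eta], so one more iterate keeps them within [xi]
   and conformality still applies; passing [eta] at time [k] gives [lambda ^- k < m / eta]. *)
have [k km kmin] := ex_minnP (exists_exp_gt eta lambda_gt1 m0).
have lp n : 0 < lambda ^+ n by rewrite exprn_gt0// lambda_gt0.
have grow a b : Wloc f sg xi a b -> mdist a b <= m ->
    mdist (fpow f (opp_side sg) k a) (fpow f (opp_side sg) k b)
    = lambda ^+ k * mdist a b.
  move=> ab abm; apply: Wloc_opp_fpow_dist.
  have : (k <= k)%N by [].
  move: {1 3 4}k; elim=> [|j IHj] jk; first by case: (sg) ab.
  have B := IHj (ltnW jk).
  have := @Wloc_opp_fpow sg xi 1 _ _ B; rewrite -!fpowD; apply=> -[_|[|//] _].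
    by rewrite metric_sym; have := B 0%N; case: (sg).
  apply: etaP; rewrite Wloc_opp_fpow_dist//.
  apply: (@le_trans _ _ (lambda ^+ j * m)); first by rewrite ler_pM2l.
  by rewrite leNgt; apply/negP => /kmin; rewrite leqNgt jk.
have := metric_triangle (fpow f (opp_side sg) k y) (fpow f (opp_side sg) k x)
  (fpow f (opp_side sg) k w).
have := metric_triangle (fpow f (opp_side sg) k x) (fpow f (opp_side sg) k z)
  (fpow f (opp_side sg) k w).
have := metric_triangle (fpow f (opp_side sg) k x) (fpow f (opp_side sg) k y)
  (fpow f (opp_side sg) k z).
have := metric_triangle (fpow f (opp_side sg) k y) (fpow f (opp_side sg) k w)
  (fpow f (opp_side sg) k z).
rewrite (metric_sym (fpow _ _ k y) (fpow _ _ k x)).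
rewrite (metric_sym (fpow _ _ k w) (fpow _ _ k z)).
rewrite !(grow _ _ xz)// !(grow _ _ yw)//.
rewrite !(Wloc_fpow_dist k xy) !(Wloc_fpow_dist k zw) => H1 H2 H3 H4.
have lk : lambda ^- k * lambda ^- k <= (m / eta) ^+ 2.
  rewrite -expr2 ler_sqr ?nnegrE ?invr_ge0 ?(ltW (lp _))//; last first.
    by rewrite divr_ge0 ?(ltW m0) ?(ltW eta_gt0).
  rewrite -[leLHS]mul1r ler_pdivrMr// mulrAC ler_pdivlMr// mul1r mulrC.
  exact: ltW.
set S := mdist x y + mdist z w.
have S0 : 0 <= S by rewrite addr_ge0// mdist_ge0.
apply: (@le_trans _ _ (lambda ^- k * lambda ^- k * S)); last by rewrite ler_wpM2r.
rewrite -mulrA ler_pdivlMl// -{1}(gtr0_norm (lp k)) -normrM mulrBr ler_norml.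
by rewrite /S mulrDr; apply/andP; split; lra.
Qed.

(** When [mdist y w] is the larger side, it also appears on the right of [box_dist]. The condition
    [4 * a * b <= eta ^+ 2] allows half of it to be absorbed, which gives the ratio 2; reinserting
    this ratio replaces its square by 4 times that of [mdist x z]. *)
Lemma box_ratio sg x y z w a b :
  Wloc f sg xi x z -> Wloc f sg xi y w ->
  Wloc f (opp_side sg) xi x y -> Wloc f (opp_side sg) xi z w ->
  mdist x z <= a -> mdist y w <= a -> mdist x y <= b -> mdist z w <= b ->
  4 * a * b <= eta ^+ 2 ->
  mdist y w <= 2 * mdist x z /\
  mdist y w <= mdist x z + 4 / eta ^+ 2 * mdist x z ^+ 2 * (mdist x y + mdist z w).
Proof.
move=> xz yw xy zw xza ywa xyb zwb ab.
set u := mdist x z in xza *; set u' := mdist y w in ywa *.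
set s := mdist x y in xyb *; set s' := mdist z w in zwb *.
have [u0 u'0 s0 s'0] : [/\ 0 <= u, 0 <= u', 0 <= s & 0 <= s'].
  by split; exact: mdist_ge0.
have e0 : 0 < eta ^+ 2 by rewrite exprn_gt0.
have [le_uu'|le_u'u] := leP u' u.
  split; first by lra.
  apply: (le_trans le_uu'); rewrite lerDl !mulr_ge0 ?addr_ge0 ?sqr_ge0//.
  by rewrite invr_ge0 ltW.
have := box_dist xz yw xy zw (ltW le_u'u) (lexx _).
rewrite -/u -/u' -/s -/s' ger0_norm ?subr_ge0 ?(ltW le_u'u)// => H.
have u2 : u' <= 2 * u.
  suff : (u' / eta) ^+ 2 * (s + s') <= u' / 2 by lra.
  rewrite expr_div_n mulrAC ler_pdivrMr// expr2 -!mulrA ler_wpM2l//.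
  apply: (@le_trans _ _ (a * (2 * b))); last by lra.
  by apply: ler_pM => //; [rewrite addr_ge0|lra].
split=> //; suff : (u' / eta) ^+ 2 * (s + s') <= 4 / eta ^+ 2 * u ^+ 2 * (s + s') by lra.
rewrite ler_wpM2r ?addr_ge0// expr_div_n [leRHS]mulrAC ler_wpM2r ?invr_ge0 ?(ltW e0)//.
by rewrite !expr2; nra.
Qed.

End Box.

Lemma exists_eta : compact [set: X] -> exists2 eta : R, 0 < eta <= xi &
  forall sg x y, mdist x y <= eta -> mdist (fpow f sg 1 x) (fpow f sg 1 y) <= xi.
Proof.
move=> cX.
have [h1 h10 H1] := compact_unif_dist cX (@fpow_continuous _ _ f stable 1) xi_gt0.
have [h2 h20 H2] := compact_unif_dist cX (@fpow_continuous _ _ f unstable 1) xi_gt0.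
exists (Num.min xi (Num.min h1 h2)).
  by rewrite !lt_min xi_gt0 h10 h20 ge_min lexx.
by move=> [] x y; rewrite !le_min => /and3P[_ xy1 xy2]; [exact: H1|exact: H2].
Qed.

Section Bracket.
Hypothesis hlps : local_product_structure f.

Lemma lps_side sg e : 0 < e -> exists2 delta : R, 0 < delta & forall p q,
  mdist p q < delta -> exists w, Wloc f sg e p w /\ Wloc f (opp_side sg) e q w.
Proof.
move=> /hlps[delta d0 H]; exists delta => // p q pq; case: sg.
  by have [w []] := H _ _ pq; exists w.
by rewrite metric_sym in pq; have [w []] := H _ _ pq; exists w.
Qed.

(* Expansiveness with a rate; the local product point of [w] and [w'] is close
   to both of them because it expands in only one time direction from each. *)
Lemma expansive_rate : exists2 e : R, 0 < e & forall n w w',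
  (forall sg k, (k <= n)%N -> mdist (fpow f sg k w) (fpow f sg k w') <= e) ->
  mdist w w' <= 2 * (lambda ^- n * xi).
Proof.
have xi20 : 0 < xi / 2 by rewrite divr_gt0// xi_gt0.
have [delta d0 H] := lps_side stable xi20.
have delta20 : 0 < delta / 2 by rewrite divr_gt0.
have [e e0 [e_xi e_delta]] := exists_gt0_le2 xi20 delta20.
exists e => // n w w' ww'.
have [|v [wv w'v]] := H w w'.
  by have : mdist w w' <= _ := ww' stable 0%N isT; lra.
have near sg k : (k <= n)%N -> mdist (fpow f sg k w) (fpow f sg k w') <= xi / 2.
  by move=> /(ww' sg) /le_trans; apply.
have close sg a b : Wloc f sg (xi / 2) a v -> Wloc f (opp_side sg) (xi / 2) b v ->
    (forall k, (k <= n)%N ->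
      mdist (fpow f (opp_side sg) k a) (fpow f (opp_side sg) k b) <= xi / 2) ->
    mdist a v <= lambda ^- n * xi.
  move=> av bv ab.
  have av' : Wloc f sg xi (fpow f (opp_side sg) n a) (fpow f (opp_side sg) n v).
    apply: Wloc_opp_fpow => [|j jn]; first by apply: Wloc_le av; have := xi_gt0; lra.
    have := metric_triangle (fpow f (opp_side sg) j a)
      (fpow f (opp_side sg) j b) (fpow f (opp_side sg) j v).
    by have := ab j jn; have := Wloc_sym bv j; lra.
  rewrite ler_pdivlMl ?exprn_gt0 ?lambda_gt0// -(Wloc_opp_fpow_dist av').
  exact: Wloc_dist av'.
have := metric_triangle w v w'.
have := close stable w w' wv w'v (near unstable).
have wv' : mdist v w' <= lambda ^- n * xi.
  rewrite metric_sym; apply: (close unstable w' w w'v wv) => k kn.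
  by rewrite metric_sym; exact: near.
by lra.
Qed.

(** Any selection [w] of product points is continuous. Up to time [n], [w v] follows [p v] within
    [e] in the direction [sg] and [q v] in the other; for [v] near [v0] the orbits of [w v] and
    [w v0] therefore stay within three times [e0], the threshold of [expansive_rate], in both
    directions. *)
Lemma bracket_continuous : exists2 e0 : R, 0 < e0 &
  forall sg e (T : topologicalType) (p q w : T -> X) (v0 : T), e <= e0 ->
  p v @[v --> v0] --> p v0 -> q v @[v --> v0] --> q v0 ->
  (forall v, Wloc f sg e (p v) (w v) /\ Wloc f (opp_side sg) e (q v) (w v)) ->
  w v @[v --> v0] --> w v0.
Proof.
have [e1 e10 H] := expansive_rate.
have e30 : 0 < e1 / 3 by rewrite divr_gt0.
exists (e1 / 3) => // sg e T p q w v0 ee0 pc qc wP.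
apply/continuousPdist => eps eps0.
have [n neps] : exists n, 2 * (lambda ^- n * xi) <= eps.
  have [n n_eps] := exists_exp_gt (2 * xi) lambda_gt1 eps0.
  exists n; rewrite mulrCA ler_pdivrMl ?exprn_gt0 ?lambda_gt0//; exact: ltW.
have side sg' (r : T -> X) : r v @[v --> v0] --> r v0 ->
    (forall v, Wloc f sg' e (r v) (w v)) -> \forall v \near v0,
      forall k, (k <= n)%N -> mdist (fpow f sg' k (w v0)) (fpow f sg' k (w v)) <= e1.
  move=> rc rw.
  have : \forall v \near v0, forall k, (k < n.+1)%N ->
      mdist (fpow f sg' k (r v0)) (fpow f sg' k (r v)) <= e1 / 3.
    elim: (n.+1) => [|m IHm]; first by apply: nearW.
    have rm : fpow f sg' m (r v) @[v --> v0] --> fpow f sg' m (r v0).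
      by apply: continuous_cvg => //; exact: fpow_continuous.
    have rme := (continuousPdist (fpow f sg' m \o r) v0).1 rm _ e30.
    apply: filterS2 IHm rme => v IH Hm k.
    by rewrite ltnS leq_eqVlt => /predU1P[->//|/IH].
  apply: filterS => v rv k kn.
  have := rv k kn; have := rw v0 k; have := rw v k.
  have := metric_triangle (fpow f sg' k (w v0)) (fpow f sg' k (r v0)) (fpow f sg' k (w v)).
  have := metric_triangle (fpow f sg' k (r v0)) (fpow f sg' k (r v)) (fpow f sg' k (w v)).
  rewrite (metric_sym (fpow f sg' k (w v)) (fpow f sg' k (r v))); lra.
have := side sg p pc (fun v => (wP v).1).
have := side (opp_side sg) q qc (fun v => (wP v).2).
apply: filterS2 => v Hq Hp; apply: le_trans neps; apply: H => sg' k kn.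
have [->|->] : sg' = sg \/ sg' = opp_side sg by case: (sg); case: sg'; auto.
  exact: Hp.
exact: Hq.
Qed.

End Bracket.
End Conformal.

(** * Curves inside a leaf *)

Section Clamp.
Context {R : realType}.
Implicit Types a b v : R.

Definition clamp a b v : R := Num.max a (Num.min b v).

Lemma clamp_id a b v : a <= v <= b -> clamp a b v = v.
Proof. by move=> /andP[av vb]; rewrite /clamp min_r// max_r. Qed.

Lemma clamp_bounds a b v : a <= b -> a <= clamp a b v <= b.
Proof. by move=> ab; rewrite /clamp le_max lexx ge_max ab ge_min lexx. Qed.

Lemma clamp_continuous a b : continuous (clamp a b).
Proof.
move=> v; apply: (@continuous_max R R (cst a) (Num.min b : R -> R)).
  exact: cvg_cst.
by apply: (@continuous_min R R (cst b) id); [exact: cvg_cst|exact: cvg_id].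
Qed.

Lemma minr_continuous b : continuous (Num.min b : R -> R).
Proof.
move=> v; apply: (@continuous_min R R (cst b) id); [exact: cvg_cst|exact: cvg_id].
Qed.

Lemma min_lip b v w : `|Num.min b v - Num.min b w| <= `|v - w|.
Proof.
rewrite /Num.min; case: (ltP b v) => bv; case: (ltP b w) => bw //.
- by rewrite subrr normr0.
- by rewrite !ger0_norm ?subr_ge0 ?(ltW (le_lt_trans bw bv))// lerB// ltW.
- rewrite distrC (distrC v) !ger0_norm ?subr_ge0 ?(le_trans bv (ltW bw))//.
  by rewrite lerB// ltW.
Qed.

Lemma clamp_comp_continuous (T : topologicalType) a b (g : R -> T) : a <= b ->
  {within `[a, b], continuous g} -> continuous (g \o clamp a b).
Proof.
move=> ab /subspace_continuousP gc v.
have vin : clamp a b v \in `[a, b] by rewrite in_itv/= clamp_bounds.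
move=> B gB; have := gc _ vin _ gB; rewrite /= nbhs_simpl/= /within/= => H.
have := @clamp_continuous a b v _ H; rewrite /= nbhs_simpl/=.
apply: filterS => u; apply.
by rewrite /= in_itv/= clamp_bounds.
Qed.

End Clamp.

(** If [A] were uncountable, the sets containing all but countably many points of [A] would form a
    proper filter; at a cluster point, the complement of a neighbourhood with countable trace
    belongs to it, a contradiction. *)
Lemma locally_countable (T : topologicalType) (A : set T) :
  compact [set: T] -> (forall x : T, exists2 U, nbhs x U & countable (A `&` U)) ->
  countable A.
Proof.
move=> cT H; apply: contrapT => Ac.
pose F : set_system T := [set S | countable (A `\` S)].
have cntU (B C : set T) : countable B -> countable C -> countable (B `|` C).
  move=> cB cC; rewrite (_ : B `|` C = \bigcup_(i in [set: bool]) if i then B else C).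
    by apply: bigcup_countable => [|[]//].
  apply/seteqP; split=> [x [Bx|Cx]|x [[] _]]; first by exists true.
  - by exists false.
  - by left.
  - by right.
have FF : ProperFilter F.
  split; first by rewrite /F/= setD0.
  split.
  - by rewrite /F/= setDT.
  - by move=> S S' FS FS'; rewrite /F/= setDIr; exact: cntU.
  - move=> S S' SS' FS; apply: sub_countable FS; apply: subset_card_le.
    exact: setDS.
have [x [_ xF]] : [set: T] `&` cluster F !=set0 by apply: cT; exact: filterT.
have [U Ux AU] := H x.
have [|y []//] := xF (~` U) U _ Ux.
by rewrite /F/= setDE setCK.
Qed.

(** By the intermediate value theorem the distance to [c a] takes every value of an interval of
    positive measure, which is uncountable. *)
Lemma countable_range_const (R : realType) (X : metricType R) (c : R -> X) :
  continuous c -> countable (range c) -> forall a b, c a = c b.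
Proof.
move=> cc cntc a b; wlog ab : a b / a <= b.
  by move=> H; case: (leP a b) => [|/ltW] /H.
apply: contrapT => cab.
have d0 : 0 < mdist (c a) (c b) by rewrite mdist_gt0; exact/eqP.
pose psi v := mdist (c a) (c v).
have psic : continuous psi.
  by move=> v; apply: continuous_comp; [exact: cc|exact: continuous_mdist_l].
have cnt : countable (`[0, psi b] : set R).
  apply: sub_countable (sub_countable (card_image_le (mdist (c a)) _) cntc).
  apply: subset_card_le => r; rewrite /= in_itv/= => /andP[r0 rb].
  have [|v _ <-] := @IVT R psi a b r ab (continuous_subspaceT psic).
    by rewrite /psi mdistxx min_l ?mdist_ge0// max_r ?mdist_ge0// r0.
  by exists (c v) => //; exists v.
have := countable_lebesgue_measure0 cnt.
by rewrite lebesgue_measure_itv/= lte_fin d0 sube0 => -[] /eqP; rewrite gt_eqF.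
Qed.

Section LeafCurves.
Context {R : realType} {X : metricType R} (f : homeo X) (xi lambda : R).
Context (hconf : conformal_hyperbolic f xi lambda).
Hypothesis cX : compact [set: X].
Hypothesis hlps : local_product_structure f.

(** The leaf is the union over [n] of the points whose [n]-th iterate is in the local set of that of
    [x]. Within the slice each such piece [A n] is locally a single point: two points close during
    the first [n] iterates stay close later through the orbit of [x], and in the other direction
    through that of [q], so [Wloc_eq] applies. *)
Lemma leaf_slice_countable sg x q e : e <= xi / 2 ->
  countable (W f sg x `&` Wloc f (opp_side sg) e q).
Proof.
move=> exi; have xi0 := xi_gt0 hconf.
have xi20 : 0 < xi / 2 by rewrite divr_gt0.
pose A n := [set y | Wloc f (opp_side sg) e q y /\
  Wloc f sg (xi / 2) (fpow f sg n x) (fpow f sg n y)].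
apply: (@sub_countable _ _ _ (\bigcup_n A n)).
  apply: subset_card_le => y [/(W_Wloc xi20)[n xy] qy]; by exists n.
apply: bigcup_countable => // n _; apply: locally_countable => // p.
exists [set y | forall k, (k < n)%N ->
    mdist (fpow f sg k p) (fpow f sg k y) <= xi / 2].
  elim: n => [|n IHn]; first by apply: nearW.
  apply: filterS2 IHn ((continuousPdist _ p).1 (@fpow_continuous _ _ f sg n p) _ xi20).
  by move=> y IH py k; rewrite ltnS leq_eqVlt => /predU1P[->//|/IH].
set B := A n `&` _.
have Beq y y' : B y -> B y' -> y = y'.
  move=> [[qy xy] py] [[qy' xy'] py'].
  have yy' : Wloc f (opp_side sg) xi y y'.
    rewrite (splitr xi); apply: Wloc_trans (Wloc_le exi qy').
    by apply: Wloc_sym; exact: Wloc_le exi qy.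
  apply: (Wloc_eq hconf (sg := sg)) yy' => k; rewrite metric_sym.
  have [nk|kn] := leqP n k.
    have := metric_triangle (fpow f sg k y) (fpow f sg k x) (fpow f sg k y').
    have := xy (k - n)%N; have := xy' (k - n)%N.
    by rewrite -!fpowD subnK// (metric_sym (fpow f sg k x)); lra.
  have := metric_triangle (fpow f sg k y) (fpow f sg k p) (fpow f sg k y').
  have := py k kn; have := py' k kn; rewrite (metric_sym (fpow f sg k p) (fpow f sg k y)).
  lra.
have [->|/set0P[y0 By0]] := eqVneq B set0; first exact: countable0.
apply: sub_countable (countable1 y0); apply: subset_card_le => y By.
exact: Beq.
Qed.

(* The bracket of the base point with the moving point is a continuous curve in
   a transverse slice, which meets the leaf in a countable set; hence it is
   constant. *)
Lemma leaf_curve_Wloc sg x (c : R -> X) e :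
  continuous c -> (forall t, W f sg x (c t)) -> 0 < e ->
  exists2 h : R, 0 < h & forall t t', t \in `[0, 1] -> `|t - t'| <= h ->
    Wloc f sg e (c t) (c t').
Proof.
move=> cc cW e0; have xi0 := xi_gt0 hconf.
have [e1 e10 brc] := bracket_continuous hconf hlps.
have xi20 : 0 < xi / 2 by rewrite divr_gt0.
have [e2 e20 [e2e1 e2xi]] := exists_gt0_le2 e10 xi20.
have [e' e'0 [e'e e'e2]] := exists_gt0_le2 e0 e20.
have [delta d0 Hlps] := lps_side hlps (opp_side sg) e'0.
have d20 : 0 < delta / 2 by rewrite divr_gt0.
have [h h0 Hh] := @compact_unif_dist R R^o X _ c _ (@segment_compact R 0 1) cc d20.
exists h => // t t' t01 tt'.
(* Restricting to this window keeps the whole curve within [delta] of [c t], so the bracket exists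
   for every real parameter. *)
pose r := clamp (t - h) (t + h).
have rt : r t = t by apply: clamp_id; lra.
have rt' : r t' = t'.
  by apply: clamp_id; move: tt'; rewrite ler_norml => /andP[]; lra.
have near v : mdist (c t) (c (r v)) < delta.
  apply: (@le_lt_trans _ _ (delta / 2)); last by lra.
  apply: Hh => //; rewrite /mdist/= distrC ler_distl.
  by have := @clamp_bounds _ (t - h) (t + h) v; rewrite -/r; lra.
have [w wP] := choice (fun v => Hlps _ _ (near v)); rewrite opp_sideK in wP.
have rc : continuous (c \o r).
  by move=> v; apply: continuous_comp; [exact: clamp_continuous|exact: cc].
have wc : continuous w.
  move=> v; apply: (brc (opp_side sg) e' R (cst (c t)) (c \o r)).
  - exact: le_trans e'e2 e2e1.
  - exact: cvg_cst.
  - exact: rc.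
  - by move=> u; rewrite opp_sideK; exact: wP.
have e'xi2 : e' <= xi / 2 by exact: le_trans e'e2 e2xi.
have e'xi : e' <= xi by lra.
have wcnt : countable (range w).
  apply: sub_countable (leaf_slice_countable sg x (c t) e'xi2).
  apply: subset_card_le => _ [v _ <-]; split; last exact: (wP v).1.
  apply: W_trans (cW (r v)) _; apply: (Wloc_W hconf).
  exact: Wloc_le e'xi (wP v).2.
(* At parameter [t] the bracket is [c t] itself; by constancy it is also the bracket at [t'], which
   places [c t] in the local set of [c t']. *)
have wtt' := countable_range_const wc wcnt t t'.
have [] := wP t; rewrite rt => wt1 wt2.
have [] := wP t'; rewrite rt' -wtt'.
rewrite -(Wloc_eq hconf (Wloc_le e'xi wt2) (Wloc_le e'xi wt1)) => _ ct't.
by apply: Wloc_sym; exact: Wloc_le e'e ct't.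
Qed.

End LeafCurves.

(** * Transport along a finite chain of boxes *)

Section Transport.
Context {R : realType} {X : metricType R} (f : homeo X) (xi lambda : R).
Context (hconf : conformal_hyperbolic f xi lambda).
Context (sg : side) (eta e delta : R) (br : X -> X -> X).
Hypothesis eta_gt0 : 0 < eta.
Hypothesis eta_xi : eta <= xi.
Hypothesis etaP : forall sg x y, mdist x y <= eta ->
  mdist (fpow f sg 1 x) (fpow f sg 1 y) <= xi.
Hypothesis e_eta : e <= eta / 4.
Hypothesis brP : forall p q, mdist p q < delta ->
  Wloc f sg e p (br p q) /\ Wloc f (opp_side sg) e q (br p q).

(** Each bracket closes a box by producing the corner opposite to [x m]. *)
Fixpoint transport (x : nat -> X) (w0 : X) (n : nat) : X :=
  if n is m.+1 then br (transport x w0 m) (x m.+1) else w0.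

Lemma eq_transport (x x' : nat -> X) w0 n :
  (forall i, (i <= n)%N -> x i = x' i) -> transport x w0 n = transport x' w0 n.
Proof.
elim: n => //= n IHn xx'; rewrite xx'// IHn// => i /leqW; exact: xx'.
Qed.

Section TransportBounds.
Variables (x : nat -> X) (w0 : X) (N : nat) (rho B s : R).
Hypothesis rho_e : rho <= e.
Hypothesis rho_delta : rho <= delta / 2.
Hypothesis xP : forall i, (i < N)%N -> Wloc f sg rho (x i) (x i.+1).
Hypothesis sumB : \sum_(0 <= i < N) mdist (x i) (x i.+1) <= B.
Hypothesis w0P : Wloc f (opp_side sg) e (x 0%N) w0.
Hypothesis w0s : mdist (x 0%N) w0 <= s.
Hypothesis s_e : 2 * s <= e.
Hypothesis s_delta : 2 * s < delta / 2.
Hypothesis s_small : 48 * B * s <= eta ^+ 2.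

Let w := transport x w0.
Let L n := \sum_(0 <= i < n) mdist (x i) (x i.+1).

Lemma transportP n : (n <= N)%N ->
  [/\ Wloc f (opp_side sg) e (x n) (w n), mdist (x n) (w n) <= 2 * s,
      mdist (x n) (w n) <= s + 48 / eta ^+ 2 * s ^+ 2 * L n &
      (n < N)%N -> [/\ mdist (w n) (x n.+1) < delta,
        Wloc f sg e (w n) (w n.+1) &
        mdist (w n) (w n.+1) <= 2 * mdist (x n) (x n.+1)]].
Proof.
move: n; have [se sd rd eg] := And4 s_e s_delta rho_delta e_eta.
have s0 : 0 <= s by apply: le_trans w0s; exact: mdist_ge0.
have e2 : 0 < eta ^+ 2 by rewrite exprn_gt0.
have e0 : 0 <= e by apply: le_trans s_e; rewrite mulr_ge0.
have ee_eta : e * e <= eta / 4 * (eta / 4) by apply: ler_pM.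
have e_xi : e <= xi by have := eta_gt0; have := eta_xi; have := e_eta; lra.
have toxi sg' e' a b : e' <= e -> Wloc f sg' e' a b -> Wloc f sg' xi a b.
  by move=> e'e; apply: Wloc_le; exact: le_trans e_xi.
have LB n : (n <= N)%N -> L n <= B.
  move=> nN; apply: le_trans sumB; rewrite /L [leRHS](big_cat_nat (n := n))//= lerDl.
  by apply: sumr_ge0 => i _; exact: mdist_ge0.
have bound n : (n <= N)%N -> mdist (x n) (w n) <= s + 48 / eta ^+ 2 * s ^+ 2 * L n ->
    mdist (x n) (w n) <= 2 * s.
  move=> nN /le_trans; apply.
  suff : 48 / eta ^+ 2 * s ^+ 2 * L n <= s by lra.
  apply: (@le_trans _ _ (48 / eta ^+ 2 * s ^+ 2 * B)).
    by rewrite ler_wpM2l ?LB// mulr_ge0 ?sqr_ge0// divr_ge0// ltW.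
  rewrite (_ : _ * B = (48 * B * s) / eta ^+ 2 * s); last by ring.
  rewrite -[leRHS]mul1r ler_wpM2r// ler_pdivrMr// mul1r//.
have box n : (n < N)%N -> Wloc f (opp_side sg) e (x n) (w n) ->
    mdist (x n) (w n) <= 2 * s ->
    [/\ mdist (w n) (x n.+1) < delta, Wloc f sg e (w n) (w n.+1),
        Wloc f (opp_side sg) e (x n.+1) (w n.+1) &
        mdist (w n) (w n.+1) <= 2 * mdist (x n) (x n.+1)].
  move=> nN xw xws.
  have wd : mdist (w n) (x n.+1) < delta.
    have := metric_triangle (w n) (x n) (x n.+1).
    by have := Wloc_dist (xP nN); rewrite (metric_sym (w n) (x n)); lra.
  have [ww xw'] := brP wd; split=> //.
  have [] := box_ratio hconf eta_gt0 etaP (toxi _ _ _ _ rho_e (xP nN))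
    (toxi _ _ _ _ (lexx _) ww) (toxi _ _ _ _ (lexx _) xw)
    (toxi _ _ _ _ (lexx _) xw') (a := e) (b := e) => //.
  - by apply: le_trans rho_e; exact: Wloc_dist (xP nN).
  - exact: Wloc_dist ww.
  - exact: Wloc_dist xw.
  - exact: Wloc_dist xw'.
  - by rewrite expr2; lra.
suff H n : (n <= N)%N -> Wloc f (opp_side sg) e (x n) (w n) /\
    mdist (x n) (w n) <= s + 48 / eta ^+ 2 * s ^+ 2 * L n.
  move=> n nN; have [xw xwL] := H n nN; split=> //; first exact: bound.
  by move=> nN'; have [] := box n nN' xw (bound n nN xwL).
elim: n => [_|n IHn nN].
  by rewrite /L big_geq// mulr0 addr0; split.
have [xw xwL] := IHn (ltnW nN).
have xws := bound _ (ltnW nN) xwL.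
have [wd ww xw' wwx] := box n nN xw xws.
split=> //.
have ww' : Wloc f (opp_side (opp_side sg)) e (w n) (w n.+1) by rewrite opp_sideK.
have xx' : Wloc f (opp_side (opp_side sg)) rho (x n) (x n.+1).
  by rewrite opp_sideK; exact: xP.
have [] := box_ratio hconf eta_gt0 etaP (toxi _ _ _ _ (lexx _) xw)
    (toxi _ _ _ _ (lexx _) xw') (toxi _ _ _ _ rho_e xx')
    (toxi _ _ _ _ (lexx _) ww') (a := e) (b := e) => //.
- exact: Wloc_dist xw.
- exact: Wloc_dist xw'.
- by apply: le_trans rho_e; exact: Wloc_dist xx'.
- exact: Wloc_dist ww.
- by rewrite expr2; lra.
move=> _ /le_trans; apply.
rewrite /L big_nat_recr//= -/(L n) [in leRHS]mulrDr [in leRHS]addrA.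
apply: lerD => //.
(* The 4 is that of [box_ratio], [2 * s] bounds the transverse side, and 3 counts the step of [x]
   once and that of [w], at most twice as long. *)
rewrite (_ : 48 / eta ^+ 2 * s ^+ 2 * mdist (x n) (x n.+1) =
  4 / eta ^+ 2 * (2 * s) ^+ 2 * (3 * mdist (x n) (x n.+1))); last by ring.
apply: ler_pM.
- by rewrite mulr_ge0 ?sqr_ge0// divr_ge0// ltW.
- by rewrite addr_ge0// mdist_ge0.
- rewrite ler_wpM2l ?divr_ge0 ?(ltW e2)// ler_sqr ?nnegrE ?mdist_ge0//.
  by rewrite mulr_ge0.
- lra.
Qed.

End TransportBounds.
End Transport.

(** * Transport of families of curves *)

Section UniformGrid.
Context {R : realType}.

Definition grid N i : R := i%:R / N%:R.

Lemma grid0 N : grid N 0 = 0. Proof. by rewrite /grid mul0r. Qed.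

Lemma gridN N : (0 < N)%N -> grid N N = 1.
Proof. by move=> N0; rewrite /grid divff// pnatr_eq0 -lt0n. Qed.

Lemma grid_ge0 N i : 0 <= grid N i.
Proof. by rewrite divr_ge0. Qed.

Lemma grid_le1 N i : (i <= N)%N -> grid N i <= 1.
Proof.
case: N => [|N] iN; first by rewrite /grid invr0 mulr0.
by rewrite ler_pdivrMr ?ltr0n// mul1r ler_nat.
Qed.

Lemma gridS N i : grid N i.+1 = grid N i + N%:R^-1.
Proof. by rewrite /grid -addn1 natrD mulrDl mul1r. Qed.

Lemma grid_le N i j : (i <= j)%N -> grid N i <= grid N j.
Proof. by move=> ij; rewrite ler_wpM2r ?invr_ge0// ler_nat. Qed.

Lemma grid_in01 N i : (i <= N)%N -> grid N i \in `[0, 1].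
Proof. by move=> iN; rewrite in_itv/= grid_ge0 grid_le1. Qed.

Lemma grid_step N i : `|grid N i - grid N i.+1| <= N%:R^-1.
Proof. by rewrite gridS opprD addNKr normrN ger0_norm ?invr_ge0. Qed.

Lemma grid_cell N t : (0 < N)%N -> 0 <= t <= 1 ->
  exists2 m, (m < N)%N & grid N m <= t <= grid N m.+1.
Proof.
move=> N0 /andP[t0 t1]; rewrite -(gridN N0) in t1.
suff H n : (n <= N)%N -> (0 < n)%N -> t <= grid N n ->
  exists2 m, (m < N)%N & grid N m <= t <= grid N m.+1 by exact: H t1.
elim: n => // n IHn nN _ tn; have [tn'|tn'] := leP t (grid N n).
  case: n => [|n] in IHn nN tn tn' *; last exact: IHn (ltnW nN) _ tn'.
  by exists 0%N => //; rewrite tn grid0 t0.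
by exists n => //; rewrite (ltW tn') tn.
Qed.

Lemma exists_grid_fine (h : R) : 0 < h ->
  exists N0, forall N, (N0 < N)%N -> N%:R^-1 <= h.
Proof.
move=> h0; exists (Num.trunc h^-1) => N N0.
rewrite -[h]invrK lef_pV2 ?posrE ?invr_gt0 ?ltr0n ?(leq_ltn_trans _ N0)//.
have := truncnS_gt h^-1; move=> /ltW /le_trans; apply.
by rewrite ler_nat.
Qed.

End UniformGrid.

Lemma sum_le_scale (R : realType) (F H : nat -> R) (c : R) n :
  (forall i, (i < n)%N -> F i <= c * H i) ->
  \sum_(0 <= i < n) F i <= c * \sum_(0 <= i < n) H i.
Proof.
by move=> FH; rewrite mulr_sumr !big_nat; apply: ler_sum => i /andP[_ /FH].
Qed.

Section Strip.
Context {R : realType} {X : metricType R} (f : homeo X) (xi lambda : R).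
Context (hconf : conformal_hyperbolic f xi lambda).
Hypothesis cX : compact [set: X].
Hypothesis hlps : local_product_structure f.
Implicit Types (G : R -> R -> X) (sg : side).

(** The bound is uniform in [r], so one mesh serves all curves of the family. *)
Definition locally_leafwise sg G := forall e : R, 0 < e ->
  exists2 h : R, 0 < h & forall t t', t \in `[0, 1] -> t' \in `[0, 1] ->
    `|t - t'| <= h -> forall r, Wloc f sg e (G t r) (G t' r).

(* The ambient [mdist] suffices: on a fine partition it is the leaf distance. *)
Definition length_le G (L : R) := forall eps : R, 0 < eps ->
  exists N0, forall N, (N0 < N)%N -> forall r,
    \sum_(0 <= i < N) mdist (G (grid N i) r) (G (grid N i.+1) r) <= L + eps.

Definition jointly_continuous G := continuous (fun v : R * R => G v.1 v.2).

(** Cells before [a] are unchanged and cells after [a] collapse. The chord of the cell cut at [a]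
    may exceed the full chord, which costs at most [rho]. *)
Lemma clipped_sum (c : R -> X) N n a rho :
  (forall i, mdist (c (Num.min (grid N i) a)) (c (Num.min (grid N i.+1) a)) <= rho) ->
  \sum_(0 <= i < n) mdist (c (Num.min (grid N i) a)) (c (Num.min (grid N i.+1) a)) <=
  \sum_(0 <= i < n) mdist (c (grid N i)) (c (grid N i.+1)) +
    (if a < grid N n then rho else 0).
Proof.
move=> H.
have rho0 : 0 <= rho by apply: le_trans (H 0%N); exact: mdist_ge0.
elim: n => [|n IHn]; first by rewrite !big_geq// add0r; case: ifP.
rewrite !big_nat_recr//=.
have le_n : grid N n <= grid N n.+1 :> R by exact: grid_le.
have d0 : 0 <= mdist (c (grid N n)) (c (grid N n.+1)) by exact: mdist_ge0.
have [an|na] := ltP a (grid N n).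
  rewrite an in IHn; rewrite (lt_le_trans an le_n) !min_r ?(ltW an) ?(le_trans (ltW an))//.
  by rewrite mdistxx addr0; move: IHn d0; lra.
rewrite ltNge na addr0 in IHn.
have [an1|n1a] := ltP a (grid N n.+1).
  have := H n; rewrite min_l// (min_r (ltW an1)); move: IHn d0; lra.
by move: IHn; lra.
Qed.

(** A step of [G] of size u becomes a step of [G'] of size at most u + K u^2. As the mesh tends to 0
    the factor 1 + K u tends to 1, so the bound [L] itself survives, not merely a multiple of it. *)
Lemma holonomy_transfer sg G G' (eta a b h L : R) :
  0 < eta -> (forall sg x y, mdist x y <= eta ->
    mdist (fpow f sg 1 x) (fpow f sg 1 y) <= xi) ->
  0 < a <= xi -> 0 <= b <= xi -> 4 * a * b <= eta ^+ 2 -> 0 < h -> 0 <= L ->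
  (forall t r, t \in `[0, 1] -> Wloc f (opp_side sg) b (G t r) (G' t r)) ->
  (forall t t' r, t \in `[0, 1] -> t' \in `[0, 1] -> `|t - t'| <= h ->
    Wloc f sg a (G' t r) (G' t' r)) ->
  locally_leafwise sg G -> length_le G L ->
  locally_leafwise sg G' /\ length_le G' L.
Proof.
move=> eta0 etaP /andP[a0 axi] /andP[b0 bxi] ab h0 L0 GG' G'a Gl GL.
have eta2 : 0 < eta ^+ 2 by rewrite exprn_gt0.
have [h1 h10 Hh1] := Gl _ a0.
have [h2 h20 [h2h h2h1]] := exists_gt0_le2 h0 h10.
pose K := 4 / eta ^+ 2 * (2 * b).
have K0 : 0 <= K by rewrite mulr_ge0 ?divr_ge0 ?(ltW eta2)// mulr_ge0.
have ratio t t' r : t \in `[0, 1] -> t' \in `[0, 1] -> `|t - t'| <= h2 ->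
    mdist (G' t r) (G' t' r) <= 2 * mdist (G t r) (G t' r) /\
    mdist (G' t r) (G' t' r) <= mdist (G t r) (G t' r) +
      K * mdist (G t r) (G t' r) ^+ 2.
  move=> t01 t'01 tt'.
  have GG := Hh1 _ _ t01 t'01 (le_trans tt' h2h1) r.
  have G'G' := G'a _ _ r t01 t'01 (le_trans tt' h2h).
  have GW := GG' _ r t01; have GW' := GG' _ r t'01.
  have [||||//|H1 H2] := box_ratio hconf eta0 etaP (Wloc_le axi GG)
    (Wloc_le axi G'G') (Wloc_le bxi GW) (Wloc_le bxi GW') (a := a) (b := b).
  - exact: Wloc_dist GG.
  - exact: Wloc_dist G'G'.
  - exact: Wloc_dist GW.
  - exact: Wloc_dist GW'.
  split=> //; apply: (le_trans H2); rewrite lerD2l /K.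
  rewrite mulrAC ler_wpM2r ?sqr_ge0// ler_wpM2l ?divr_ge0 ?(ltW eta2)//.
  by rewrite mulr_natl mulr2n; apply: lerD; [exact: Wloc_dist GW|exact: Wloc_dist GW'].
split=> [eps eps0|eps eps0].
  have eps20 : 0 < eps / 2 by rewrite divr_gt0.
  have [h3 h30 Hh3] := Gl _ eps20.
  have [h4 h40 [h4h2 h4h3]] := exists_gt0_le2 h20 h30.
  exists h4 => // t t' t01 t'01 tt' r.
  have tt'2 := le_trans tt' h4h2.
  apply: (Wloc_small hconf).
    exact: Wloc_le axi (G'a _ _ r t01 t'01 (le_trans tt'2 h2h)).
  have [H _] := ratio t t' r t01 t'01 tt'2; apply: (le_trans H).
  have := Wloc_dist (Hh3 _ _ t01 t'01 (le_trans tt' h4h3) r).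
  by rewrite ler_pdivlMr// mulrC.
have eps20 : 0 < eps / 2 by rewrite divr_gt0.
have Le : 0 < L + eps by exact: ltr_wpDl.
have K1 : 0 < K + 1 by exact: ltr_wpDl.
(* Steps of [G] shorter than [k] keep the excess [K * k * (L + eps / 2)] below [eps / 2]. *)
pose k := eps / 2 / ((K + 1) * (L + eps)).
have k0 : 0 < k by rewrite divr_gt0// mulr_gt0.
have kE : (K + 1) * k * (L + eps) = eps / 2.
  by rewrite /k mulrAC mulrCA divff ?mulr1// mulf_neq0// gt_eqF.
have [h3 h30 Hh3] := Gl _ k0.
have [h4 h40 [h4h2 h4h3]] := exists_gt0_le2 h20 h30.
have [M0 HM0] := GL _ eps20.
have [M1 HM1] := exists_grid_fine h40.
exists (maxn M0 M1) => M; rewrite gtn_max => /andP[M0M M1M] r.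
have MM := HM1 M M1M.
apply: (@le_trans _ _ ((1 + K * k) * (L + eps / 2))); last first.
  have : K * k * (L + eps / 2) <= eps / 2.
    rewrite -[leRHS]kE; apply: ler_pM.
    - by apply: mulr_ge0 => //; exact: ltW.
    - by apply: addr_ge0 => //; exact: ltW.
    - by rewrite ler_wpM2r ?(ltW k0)// lerDl.
    by rewrite lerD2l ler_pdivrMr// ler_peMr ?(ltW eps0)// ler1n.
  by move=> Kk; rewrite mulrDl mul1r [in leRHS](splitr eps) addrA lerD2l.
apply: (@le_trans _ _ ((1 + K * k) *
    \sum_(0 <= i < M) mdist (G (grid M i) r) (G (grid M i.+1) r))); last first.
  by rewrite ler_wpM2l ?HM0// addr_ge0// mulr_ge0// ltW.
apply: (sum_le_scale (F := fun i => mdist (G' (grid M i) r) (G' (grid M i.+1) r))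
  (H := fun i => mdist (G (grid M i) r) (G (grid M i.+1) r))) => i iM.
have i01 := @grid_in01 R M i (ltnW iM); have i101 := @grid_in01 R M i.+1 iM.
have st : `|grid M i - grid M i.+1 : R| <= h4 by exact: le_trans (grid_step M i) MM.
have [_ H] := ratio _ _ r i01 i101 (le_trans st h4h2).
apply: (le_trans H); rewrite mulrDl mul1r lerD2l expr2 mulrA.
rewrite ler_wpM2r ?mdist_ge0// ler_wpM2l//.
exact: Wloc_dist (Hh3 _ _ i01 i101 (le_trans st h4h3) r).
Qed.

(** Since [delta] is fixed before [G] and [G'] inherits the same [L], strips of the same width can
    be stacked. The factor 2 bound keeps a curve in place wherever its starting point is not
    displaced. *)
Lemma holonomy_strip sg L : 0 <= L -> exists2 delta : R, 0 < delta &
  forall G y, jointly_continuous G -> locally_leafwise sg G -> length_le G L ->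
  continuous y -> (forall r, Wloc f (opp_side sg) delta (G 0 r) (y r)) ->
  exists G', [/\ jointly_continuous G', locally_leafwise sg G', length_le G' L,
    forall r, G' 0 r = y r &
    forall t r, t \in `[0, 1] -> Wloc f (opp_side sg) xi (G t r) (G' t r) /\
      mdist (G t r) (G' t r) <= 2 * mdist (G 0 r) (y r)].
Proof.
move=> L0; have xi0 := xi_gt0 hconf.
have [eta /andP[eta0 eta_xi] etaP] := exists_eta hconf cX.
have [e1 e10 brc] := bracket_continuous hconf hlps.
have eta40 : 0 < eta / 4 by rewrite divr_gt0.
have [e e0 [e_eta e_e1]] := exists_gt0_le2 eta40 e10.
have [dl dl0 Hdl] := lps_side hlps sg e0.
(* For distant points the value is the dummy [p]; continuity of the choice is left to
   [bracket_continuous]. *)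
have [br brP] : exists br : X -> X -> X, forall p q, mdist p q < dl ->
    Wloc f sg e p (br p q) /\ Wloc f (opp_side sg) e q (br p q).
  have H (pq : X * X) : exists w, mdist pq.1 pq.2 < dl ->
      Wloc f sg e pq.1 w /\ Wloc f (opp_side sg) e pq.2 w.
    have [/Hdl[w wP]|ndl] := pselect (mdist pq.1 pq.2 < dl); first by exists w.
    by exists pq.1 => /ndl.
  have [br brP] := choice H; exists (fun p q => br (p, q)) => p q.
  exact: (brP (p, q)).
have eta2 : 0 < eta ^+ 2 by rewrite exprn_gt0.
(* In [L + 2], one unit is the tolerance taken in [length_le] and the other covers the clipped cell,
   as [rho <= 1]. *)
have B0 : 0 < 48 * (L + 2) by lra.
have dlt0 : 0 < eta ^+ 2 / (48 * (L + 2)) by rewrite divr_gt0.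
have e20 : 0 < e / 2 by rewrite divr_gt0.
have dl80 : 0 < dl / 8 by rewrite divr_gt0.
have [d1 d10 [d1_e d1_dl]] := exists_gt0_le2 e20 dl80.
have [delta delta0 [delta_d1 delta_eta]] := exists_gt0_le2 d10 dlt0.
exists delta => // G y Gc Gl GL yc Gy.
have dl20 : 0 < dl / 2 by rewrite divr_gt0.
have [rho1 rho10 [rho1_e rho1_dl]] := exists_gt0_le2 e0 dl20.
have [rho rho0 [rho_rho1 rho_1]] := exists_gt0_le2 rho10 (@ltr01 R).
have rho_e : rho <= e by exact: le_trans rho1_e.
have rho_dl : rho <= dl / 2 by exact: le_trans rho1_dl.
have [h h0 Hh] := Gl _ rho0.
have [N0 HN0] := GL 1 ltr01.
have [N1 HN1] := exists_grid_fine h0.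
pose N := (maxn N0 N1).+1.
have N_gt0 : (0 < N)%N by [].
have Nlen r := HN0 N (leq_maxl _ _) r; have Nh := HN1 N (leq_maxr _ _).
(* The chain stops at parameter [t] but always has [N] steps, so its endpoint is an [N]-fold bracket
   depending continuously on [(t, r)]. *)
pose x t r i := G (Num.min (grid N i) (clamp 0 1 t)) r.
pose W t r n := transport br (x t r) (y r) n.
have min01 i (t : R) : Num.min (grid N i) (clamp 0 1 t) \in `[0, 1].
  have /andP[c0 c1] : 0 <= clamp 0 1 t <= 1 by exact: clamp_bounds.
  by rewrite in_itv/= le_min grid_ge0 c0 ge_min c1 orbT.
have xP t r i : Wloc f sg rho (x t r i) (x t r i.+1).
  apply: Hh => //; apply: le_trans Nh; apply: le_trans (grid_step N i).
  rewrite ![Num.min (grid _ _) _]minC; exact: min_lip.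
have xsum t r : \sum_(0 <= i < N) mdist (x t r i) (x t r i.+1) <= L + 2.
  have := @clipped_sum (G ^~ r) N N (clamp 0 1 t) rho (fun i => Wloc_dist (xP t r i)).
  by have := Nlen r; case: ifP => _; lra.
have x0 t r : x t r 0%N = G 0 r.
  by rewrite /x grid0 min_l//; have /andP[] := clamp_bounds t (@ler01 R).
have WP t r n (nN : (n <= N)%N) :
    [/\ Wloc f (opp_side sg) e (x t r n) (W t r n),
        mdist (x t r n) (W t r n) <= 2 * mdist (G 0 r) (y r) &
        (n < N)%N -> [/\ mdist (W t r n) (x t r n.+1) < dl,
          Wloc f sg e (W t r n) (W t r n.+1) &
          mdist (W t r n) (W t r n.+1) <= 2 * mdist (x t r n) (x t r n.+1)]].
  have s_delta := Wloc_dist (Gy r).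
  have [] := @transportP R X f xi lambda hconf sg eta e dl br eta0 eta_xi etaP
    e_eta brP (x t r) (y r) N rho (L + 2) (mdist (G 0 r) (y r)) rho_e rho_dl
    (fun i _ => xP t r i) (xsum t r) _ _ _ _ _ n nN => //.
  - by rewrite x0; apply: Wloc_le (Gy r); lra.
  - by rewrite x0.
  - lra.
  - lra.
  - rewrite mulrC -ler_pdivlMr//; exact: le_trans s_delta delta_eta.
(* Once the grid has passed [t], the steps of the chain have length 0, and the ratio 2 forces the
   transported steps to be 0 as well. *)
have stat t r i j : (i <= j <= N)%N -> clamp 0 1 t <= grid N i -> W t r j = W t r i.
  move=> /andP[ij jN] ti; elim: j ij jN => [|j IHj].
    by rewrite leqn0 => /eqP ->.
  rewrite leq_eqVlt => /predU1P[->//|]; rewrite ltnS => ij jN.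
  rewrite -IHj ?(ltnW jN)//; apply/esym/mdist_positivity/le_anti.
  rewrite mdist_ge0 andbT; have [_ _ /(_ jN)[_ _ /le_trans]] := WP t r j (ltnW jN).
  have tj : clamp 0 1 t <= grid N j by exact: le_trans ti (grid_le N ij).
  apply; rewrite /x !min_r// ?mdistxx ?mulr0//.
  by exact: le_trans tj (grid_le N (leqnSn _)).
have pre t t' r m : grid N m <= clamp 0 1 t -> grid N m <= clamp 0 1 t' ->
    W t r m = W t' r m.
  move=> mt mt'; apply: eq_transport => i im; rewrite /x !min_l//.
    exact: le_trans (grid_le N im) mt'.
  exact: le_trans (grid_le N im) mt.
have Wcont n : (n <= N)%N -> continuous (fun v : R * R => W v.1 v.2 n).
  elim: n => [_ v|n IHn nN v].
    by apply: continuous_comp; [exact: cvg_snd|exact: yc].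
  have xc : continuous (fun v : R * R => x v.1 v.2 n.+1).
    move=> u; pose g (u : R * R) := (Num.min (grid N n.+1) (clamp 0 1 u.1), u.2).
    apply: (@continuous_comp _ _ _ g (fun v : R * R => G v.1 v.2)); last exact: Gc.
    have g1 : (g v).1 @[v --> u] --> (g u).1.
      apply: (@continuous_comp _ _ _ (clamp 0 1 \o fst) (Num.min (grid N n.+1))).
        by apply: continuous_comp; [exact: cvg_fst|exact: clamp_continuous].
      exact: minr_continuous.
    have g2 : (g v).2 @[v --> u] --> (g u).2 by exact: cvg_snd.
    exact: (cvg_pair g1 g2).
  apply: (brc sg e (R * R)%type (fun v => W v.1 v.2 n) (fun v => x v.1 v.2 n.+1)) => //.
  - exact: IHn (ltnW nN) v.
  - exact: xc.
  - by move=> u; have [_ _ /(_ nN)[/brP]] := WP u.1 u.2 n (ltnW nN).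
pose G' t r := W t r N.
have xN t r : t \in `[0, 1] -> x t r N = G t r.
  by rewrite in_itv/= => t01; rewrite /x clamp_id// gridN// min_r//; case/andP: t01.
have cell t r m : (m < N)%N -> grid N m <= t <= grid N m.+1 ->
    Wloc f sg e (W (grid N m) r m) (G' t r).
  move=> mN /andP[mt tm]; have ct : clamp 0 1 t = t.
    by apply: clamp_id; rewrite (le_trans (grid_ge0 N m) mt) (le_trans tm)// grid_le1.
  have cm : clamp 0 1 (grid N m : R) = grid N m.
    by apply: clamp_id; rewrite grid_ge0 grid_le1// ltnW.
  rewrite /G' (stat t r m.+1) ?mN ?leqnn ?ct// (pre _ t) ?cm ?ct//.
  by have [_ _ /(_ mN)[]] := WP t r m (ltnW mN).
(* Such parameters lie in the same or in adjacent cells. In the latter case the path runs back to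
   the left node of the first cell, on to the common node, and on to [t']: three moves of size [e].
   The bound [e <= eta / 4] leaves room for this tripling. *)
have G'l3 t t' r : t \in `[0, 1] -> t' \in `[0, 1] -> `|t - t'| <= N%:R^-1 ->
    Wloc f sg (e + e + e) (G' t r) (G' t' r).
  wlog tt' : t t' / t <= t'.
    move=> H t01 t'01 d; case: (leP t t') => [|/ltW] ?; first exact: H.
    by apply: Wloc_sym; apply: H => //; rewrite distrC.
  rewrite !in_itv/= => t01 t'01; rewrite ler_distlC => /andP[_ t't].
  have [m mN /andP[mt tm]] := grid_cell N_gt0 t01.
  have Hm := @cell t r m mN; rewrite mt tm in Hm.
  have [t'm|mt'] := leP t' (grid N m.+1).
    have H'm := @cell t' r m mN; rewrite (le_trans mt tt') t'm in H'm.
    apply: (@Wloc_le _ _ _ _ (e + e)); first by lra.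
    by apply: Wloc_trans (Wloc_sym (Hm isT)) (H'm isT).
  have m1N : (m.+1 < N)%N.
    rewrite ltn_neqAle mN andbT; apply/negP => /eqP E.
    by move: mt'; rewrite E gridN// ltNge; case/andP: t'01 => _ ->.
  have H'm := @cell t' r m.+1 m1N.
  rewrite (ltW mt') [t' <= _]( _ : _ = true) in H'm; last first.
    by rewrite gridS; apply: le_trans t't _; rewrite lerD2r.
  have Hm1 := @cell (grid N m.+1) r m mN.
  rewrite lexx grid_le// /G' (stat (grid N m.+1) r m.+1 N) ?mN ?leqnn// in Hm1; last first.
    by rewrite clamp_id// grid_ge0 grid_le1.
  apply: Wloc_trans (H'm isT); apply: Wloc_trans (Hm1 isT).
  exact: Wloc_sym (Hm isT).
have e30 : 0 < e + e + e <= xi by apply/andP; split; lra.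
have exi : 0 <= e <= xi by apply/andP; split; lra.
have e_small : 4 * (e + e + e) * e <= eta ^+ 2.
  have : e * e <= eta / 4 * (eta / 4) by apply: ler_pM => //; exact: ltW.
  by rewrite expr2; lra.
have N10 : 0 < (N%:R^-1 : R) by rewrite invr_gt0 ltr0n.
have GG' t r : t \in `[0, 1] -> Wloc f (opp_side sg) e (G t r) (G' t r).
  by move=> t01; have [GW _ _] := WP t r N (leqnn N); rewrite xN in GW.
have [G'l G'L] := holonomy_transfer eta0 etaP e30 exi e_small N10 L0 GG' G'l3 Gl GL.
exists G'; split=> //.
- exact: Wcont.
- move=> r; rewrite /G' (stat 0 r 0%N) ?leq0n ?leqnn//.
  by rewrite clamp_id ?grid0 ?lexx ?ler01.
- move=> t r t01; have [GW GWd _] := WP t r N (leqnn N).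
  rewrite !xN// in GW GWd; split=> //.
  by apply: Wloc_le GW; lra.
Qed.

End Strip.

(** * Global holonomy *)

Section GlobalHolonomy.
Context {R : realType} {X : metricType R} (f : homeo X) (xi lambda : R).
Context (hconf : conformal_hyperbolic f xi lambda).
Hypothesis cX : compact [set: X].
Hypothesis hlps : local_product_structure f.

Lemma leaf_dist_Wloc sg y z :
  Wloc f sg xi y z -> leaf_dist f xi lambda sg y z = mdist y z.
Proof.
move=> yz; rewrite /leaf_dist; suff -> : entry_time f xi sg y z = 0%N.
  by rewrite expr0 mul1r; case: sg {yz}.
rewrite /entry_time; case: pselect => // ex.
case: ex_minnP => n _ /(_ 0%N); rewrite leqn0 => H; apply/eqP/H/asboolP.
by case: (sg) yz.
Qed.

Lemma leaf_dist_ge0 sg y z : 0 <= leaf_dist f xi lambda sg y z.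
Proof.
by rewrite mulr_ge0 ?mdist_ge0// exprn_ge0// ltW// (lambda_gt0 hconf).
Qed.

Definition grid_seq N : seq R := [seq grid N i | i <- iota 1 N].

Lemma nth_grid_seq (b : R) N i : (i <= N)%N -> nth b (0 :: grid_seq N) i = grid N i.
Proof.
move=> iN; rewrite -(grid0 N) (_ : _ :: _ = [seq grid N i | i <- iota 0 N.+1])//.
by rewrite (nth_map 0%N) ?size_iota ?ltnS// nth_iota// ltnS.
Qed.

Lemma grid_seq_partition N : (0 < N)%N -> itv_partition 0 1 (grid_seq N).
Proof.
move=> N0; split.
  have H : {homo (grid N : nat -> R) : i j / (i < j)%N >-> i < j}.
    by move=> i j ij; rewrite ltr_pM2r ?invr_gt0 ?ltr0n// ltr_nat.
  have : sorted <%R [seq (grid N i : R) | i <- iota 0 N.+1].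
    exact: homo_sorted H _ (iota_ltn_sorted _ _).
  by rewrite /= grid0.
have := @nth_grid_seq 0 N N (leqnn N); rewrite gridN// => <-.
by rewrite (last_nth 0) size_map size_iota.
Qed.

(** On a fine grid consecutive points share a [xi]-local set, so the entry time is 0 and partition
    sums are sums of ambient distances. The family, constant in [r], starts the induction over
    strips. *)
Lemma leaf_length_length_le sg gamma : leaf_curve f sg 0 1 gamma ->
  (leaf_length f xi lambda sg 0 1 gamma < +oo)%E ->
  exists2 L : R, 0 <= L & locally_leafwise f sg (fun t _ => gamma (clamp 0 1 t)) /\
    length_le (fun t _ => gamma (clamp 0 1 t)) L.
Proof.
move=> [gc [x gx]] len.
have gcc := clamp_comp_continuous ler01 gc.
have cW t : W f sg x ((gamma \o clamp 0 1) t).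
  by apply: gx; exists (clamp 0 1 t) => //=; rewrite in_itv/= clamp_bounds.
have Hl := leaf_curve_Wloc hconf cX hlps gcc cW.
set l := leaf_length _ _ _ _ _ _ _ in len.
have ub N : (0 < N)%N ->
    ((partition_length f xi lambda sg 0 1 gamma (grid_seq N))%:E <= l)%E.
  move=> N0; apply: ereal_sup_ubound; exists (grid_seq N) => //.
  exact: grid_seq_partition.
have pl0 : 0 <= partition_length f xi lambda sg 0 1 gamma (grid_seq 1).
  by apply: sumr_ge0 => i _; exact: leaf_dist_ge0.
have l0 : (0 <= l)%E by apply: le_trans (ub 1%N isT); rewrite lee_fin.
have lfin : l \is a fin_num by rewrite ge0_fin_numE.
exists (fine l); first exact: fine_ge0.
split=> [e /Hl[h h0 Hh]|eps eps0].
  by exists h => // t t' t01 _ tt' r; exact: Hh.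
have [h h0 Hh] := Hl _ (xi_gt0 hconf).
have [N0 HN0] := exists_grid_fine h0.
exists N0 => N N0N r; have N_gt0 : (0 < N)%N by exact: leq_ltn_trans N0N.
apply: (@le_trans _ _ (partition_length f xi lambda sg 0 1 gamma (grid_seq N))); last first.
  apply: ler_wpDr; first exact: ltW.
  by rewrite -lee_fin fineK// ub.
rewrite /partition_length size_map size_iota le_eqVlt; apply/orP; left; apply/eqP.
apply: eq_big_nat => i /andP[_ iN]; have /= seqS := nth_grid_seq 1 iN.
rewrite /= seqS nth_grid_seq ?(ltnW iN)//.
have i01 := @grid_in01 R N i (ltnW iN); have i101 := @grid_in01 R N i.+1 iN.
have := Hh _ (grid N i.+1) i01 (le_trans (grid_step N i) (HN0 N N0N)).
rewrite /= (clamp_id i01) (clamp_id i101) => ii.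
by rewrite leaf_dist_Wloc; [exact: metric_sym|exact: Wloc_sym].
Qed.

Lemma locally_leafwise_W sg G t r : locally_leafwise f sg G -> t \in `[0, 1] ->
  W f sg (G 0 r) (G t r).
Proof.
move=> Gl t01; have [h h0 Hh] := Gl _ (xi_gt0 hconf).
have [N0 HN0] := exists_grid_fine h0; have N0h := HN0 N0.+1 (leqnn _).
have GW : forall i, (i <= N0.+1)%N -> W f sg (G 0 r) (G (grid N0.+1 i) r).
  elim=> [_|i IHi iN]; first by rewrite grid0; exact: W_refl.
  apply: W_trans (IHi (ltnW iN)) _; apply: (Wloc_W hconf); apply: Hh.
  - exact: grid_in01 (ltnW iN).
  - exact: grid_in01.
  - exact: le_trans (grid_step _ _) N0h.
have [m mN /andP[mt tm]] := grid_cell (ltn0Sn N0) (t01 : 0 <= t <= 1).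
apply: W_trans (GW m (ltnW mN)) _; apply: (Wloc_W hconf); apply: Hh => //.
  exact: grid_in01 (ltnW mN).
apply: le_trans N0h; rewrite distrC ger0_norm ?subr_ge0//.
by rewrite lerBlDl -gridS.
Qed.

Lemma rectifiable_holonomy sg gamma sigma :
  leaf_curve f sg 0 1 gamma ->
  (leaf_length f xi lambda sg 0 1 gamma < +oo)%E ->
  leaf_curve f (opp_side sg) 0 1 sigma -> sigma 0 = gamma 0 ->
  exists G, [/\ jointly_continuous G,
    forall r, r \in `[0, 1] -> G 0 r = sigma r,
    forall t, t \in `[0, 1] -> G t 0 = gamma t,
    forall t r, t \in `[0, 1] -> W f (opp_side sg) (gamma t) (G t r) &
    forall t r, t \in `[0, 1] -> W f sg (G 0 r) (G t r)].
Proof.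
move=> gleaf glen [sc [x sx]] s0.
have [L L0 [Gl0 GL0]] := leaf_length_length_le gleaf glen.
have [delta delta0 strip] := holonomy_strip hconf cX hlps sg L0.
pose s : R -> X := sigma \o clamp 0 1.
have scc : continuous s := clamp_comp_continuous ler01 sc.
have sW t : W f (opp_side sg) x (s t).
  by apply: sx; exists (clamp 0 1 t) => //=; rewrite in_itv/= clamp_bounds.
have [h h0 Hh] := leaf_curve_Wloc hconf cX hlps scc sW delta0.
have [M0 HM0] := exists_grid_fine h0; pose M := M0.+1.
have Mh : M%:R^-1 <= h by exact: HM0.
(* The transverse curve is frozen after [grid M j]: [y 0] is constant, [y M] is the whole curve, and
   consecutive stages differ by at most one mesh step. *)
pose y j (r : R) := s (Num.min (grid M j) (clamp 0 1 r)).
have clamp01 (r : R) : 0 <= clamp 0 1 r <= 1 by exact: clamp_bounds.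
have yc j : continuous (y j).
  move=> r; apply: (@continuous_comp _ _ _ (Num.min (grid M j) \o clamp 0 1) s).
    by apply: continuous_comp; [exact: clamp_continuous|exact: minr_continuous].
  exact: scc.
have yP j r : Wloc f (opp_side sg) delta (y j r) (y j.+1 r).
  apply: Hh.
    by have /andP[c0 c1] := clamp01 r; rewrite in_itv/= le_min grid_ge0 c0 ge_min c1 orbT.
  apply: le_trans Mh; apply: le_trans (grid_step M j).
  by rewrite ![Num.min (grid _ _) _]minC; exact: min_lip.
have clamp00 : clamp 0 1 0 = 0 :> R by apply: clamp_id; rewrite lexx ler01.
have y00 j : y j 0 = sigma 0.
  by rewrite /y /s/= clamp00 min_r ?grid_ge0// clamp00.
have [G [Gc Gl _ G0 [GW G00]]] : exists G, [/\ jointly_continuous G,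
    locally_leafwise f sg G, length_le G L, forall r, G 0 r = y M r &
    (forall t r, t \in `[0, 1] -> W f (opp_side sg) (gamma t) (G t r)) /\
    (forall t, t \in `[0, 1] -> G t 0 = gamma t)].
  elim: (M) => [|j [G [Gc Gl GL G0 [GW G00]]]].
    exists (fun t _ => gamma (clamp 0 1 t)); split=> //.
    - case: gleaf => gc _ v.
      apply: (@continuous_comp _ _ _ fst (gamma \o clamp 0 1)); first exact: cvg_fst.
      exact: (clamp_comp_continuous ler01 gc).
    - move=> r; rewrite /y /s/= grid0 min_l; last by have /andP[] := clamp01 r.
      by rewrite clamp00 s0.
    - split=> [t r|t] t01; rewrite clamp_id//; exact: W_refl.
  have [|G' [G'c G'l G'L G'0 G'W]] := strip G (y j.+1) Gc Gl GL (yc j.+1).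
    by move=> r; rewrite G0; exact: yP.
  exists G'; split=> //; split=> [t r t01|t t01].
    by apply: W_trans (GW t r t01) _; apply: (Wloc_W hconf); exact: (G'W t r t01).1.
  (* At [r = 0] no stage displaces the starting point, so the factor 2 bound leaves the whole curve
     [gamma] unmoved. *)
  have := (G'W t 0 t01).2; rewrite G0 !y00 mdistxx mulr0 G00// => d0.
  by apply/esym/mdist_positivity/le_anti; rewrite d0 mdist_ge0.
exists G; split=> //.
- move=> r r01; rewrite G0 /y gridN// min_r; last by have /andP[] := clamp01 r.
  by rewrite /s/= !clamp_id// clamp_id.
- move=> t r t01; exact: locally_leafwise_W.
Qed.

End GlobalHolonomy.

Theorem theorem2 (R : realType) (X : metricType R) (f : homeo X)
    (xi lambda : R) :
  peano_continuum X ->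
  topologically_hyperbolic f ->
  conformal_hyperbolic f xi lambda ->
  (forall gammau : R -> X,
     leaf_curve f unstable 0 1 gammau ->
     (0 < leaf_length f xi lambda unstable 0 1 gammau)%E ->
     (leaf_length f xi lambda unstable 0 1 gammau < +oo)%E ->
     global_holonomy_unstable f gammau) /\
  (forall gammas : R -> X,
     leaf_curve f stable 0 1 gammas ->
     (0 < leaf_length f xi lambda stable 0 1 gammas)%E ->
     (leaf_length f xi lambda stable 0 1 gammas < +oo)%E ->
     global_holonomy_stable f gammas).
Proof.
move=> [cX _ _] [_ hlps] hconf.
have slice1 (G : R -> R -> X) t : jointly_continuous G -> continuous (G t).
  move=> Gc r; apply: (@continuous_comp _ _ _ (pair t) (fun v => G v.1 v.2)); last exact: Gc.
  exact: (cvg_pair (cvg_cst t) (@cvg_id _ (nbhs r))).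
have slice2 (G : R -> R -> X) r : jointly_continuous G -> continuous (G ^~ r).
  move=> Gc t; apply: (@continuous_comp _ _ _ (pair^~ r) (fun v => G v.1 v.2)); last exact: Gc.
  exact: (cvg_pair (@cvg_id _ (nbhs t)) (cvg_cst r)).
split=> [gammau gu _ len gammas gs gs0|gammas gs _ len gammau gu gu0].
  have [G [Gc G0 G00 Gs Gu]] := rectifiable_holonomy hconf cX hlps gu len gs gs0.
  exists (fun v => G v.1 v.2); split=> //.
  - exact: continuous_subspaceT.
  - move=> t t01; split; first by apply: continuous_subspaceT; exact: slice1.
    by exists (gammau t) => _ [r _ <-]; exact: Gs.
  - move=> r r01; split; first by apply: continuous_subspaceT; exact: slice2.
    by exists (G 0 r) => _ [t t01 <-]; exact: Gu.
have [G [Gc G0 G00 Gu Gs]] := rectifiable_holonomy hconf cX hlps gs len gu gu0.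
(* Here the first argument of [G] runs along the stable curve, while the first coordinate in
   [holonomy] runs along the unstable one; hence the exchange. *)
exists (fun v => G v.2 v.1); split=> //.
- apply: continuous_subspaceT => v.
  apply: (@continuous_comp _ _ _ (fun v => (v.2, v.1)) (fun v => G v.1 v.2)); last exact: Gc.
  exact: (cvg_pair (@cvg_snd _ _ (nbhs v.1) (nbhs v.2) _)
    (@cvg_fst _ _ (nbhs v.1) (nbhs v.2) _)).
- move=> t t01; split; first by apply: continuous_subspaceT; exact: slice2.
  by exists (G 0 t) => _ [r r01 <-]; exact: Gs.
- move=> r r01; split; first by apply: continuous_subspaceT; exact: slice1.
  by exists (gammas r) => _ [t _ <-]; exact: Gu.
Qed.
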